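(* Let $T>0$, $\ell>0$. Let $a,f\in C([0,T]\times[-\ell,\ell]\times\mathbb{R}\times\mathbb{R})$ and $b(\cdot,-\ell,\cdot,\cdot),\,g(\cdot,-\ell,\cdot,\cdot)\in C([0,T]\times\mathbb{R}\times\mathbb{R})$ be real-valued with $a>0$ and $b(\cdot,-\ell,\cdot,\cdot)>0$. Let $u^0:[-\ell,\ell]\to\mathbb{R}$ satisfy $|u^0(x)-u^0(y)|\le K|x-y|$ for $x,y\in[-\ell,\ell]$. Let $M>0$ and suppose that there are $q_0\ge K$ and $\psi\in C^1([0,\infty),[1,\infty))$ with $$\int_{q_0}^\infty\frac{\rho\,d\rho}{\psi(\rho)}>2M$$ such that $$|f(t,x,z,p)|\le a(t,x,z,p)\,\psi(|p|),\qquad (t,x,z,p)\in\overline{\Omega}_T\times[-M,M]\times\mathbb{R},$$ and $$-g(t,-\ell,z,p)\le b(t,-\ell,z,p)p,\qquad g(t,-\ell,z,-p)\le b(t,-\ell,z,-p)p$$ for all $(t,z)\in(0,T]\times[-M,M]$ and $p\ge q_0$. Then there exists a constant $M_1=M_1(q_0,M,\psi,K)$ such that the following holds: if $0<\tau\le T$ and $u$ is any classical solution on $\Omega_\tau$ to $$u_t-a(t,x,u,u_x)u_{xx}=f(t,x,u,u_x),\qquad (t,x)\in(0,\tau)\times(-\ell,\ell),$$ with the dynamical boundary condition at $x=-\ell$ $$u_t-b(t,-\ell,u,u_x)u_x=g(t,-\ell,u,u_x),\qquad t\in(0,\tau),$$ and the homogeneous Dirichlet condition $u(t,\ell)=0$,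 $t\in(0,\tau)$, subject to $u(0,\cdot)=u^0$ on $[-\ell,\ell]$ and satisfying $|u|_{\Omega_\tau}\le M$, then $|u_x|_{\Omega_\tau}\le M_1$.
   Context: $\Omega_\tau=(0,\tau)\times(-\ell,\ell)$; $|v|_{\Omega_\tau}=\sup_{\Omega_\tau}|v|$. A classical solution on $\Omega_\tau$ is a function $u\in C^{1,2}(\Omega_\tau)\cap C(\overline{\Omega}_\tau)$ (that is, $u$ is continuous on $\overline{\Omega}_\tau$ and has continuous derivatives $u_t,u_{xx}$ on $\Omega_\tau$) whose derivatives $u_t(\cdot,\pm\ell)$ and $u_x(\cdot,\pm\ell)$ are defined on $(0,\tau)$ and which satisfies the equation and the boundary conditions pointwise. *)

(* Defs.v *)
From HB Require Import structures.
From mathcomp Require Import all_boot all_order all_algebra.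
From mathcomp Require Import all_classical all_reals all_analysis.

Set Implicit Arguments.
Unset Strict Implicit.
Unset Printing Implicit Defensive.

Import Order.TTheory GRing.Theory Num.Theory.
Import numFieldNormedType.Exports.

Local Open Scope classical_set_scope.
Local Open Scope ring_scope.

(* Derivative of the restriction of f to A: two-sided at interior points of A,
   one-sided at the endpoints of an interval A.  It does not depend on the
   values of f outside A. *)
Definition derivable_within (R : realType) (A : set R) (f : R -> R) (x : R) :
    Prop :=
  cvg ((f y - f x) / (y - x) @[y --> within A x^']).

Definition derive_within (R : realType) (A : set R) (f : R -> R) (x : R) : R :=
  lim ((f y - f x) / (y - x) @[y --> within A x^']).

Definition C1_within (R : realType) (A : set R) (f : R -> R) : Prop :=
  (forall x : R, A x -> derivable_within A f x) /\
  {within A, continuous (derive_within A f)}.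

Definition supnorm (R : realType) (T : Type) (D : set T) (v : T -> R) :
    \bar R :=
  ereal_sup [set `|v q|%:E | q in D].

Definition Omega (R : realType) (l tau : R) : set (R * R) :=
  `]0, tau[ `*` `](- l), l[.

Definition cOmega (R : realType) (l tau : R) : set (R * R) :=
  `[0, tau] `*` `[(- l), l].

Definition D_t (R : realType) (u : R * R -> R) (q : R * R) : R :=
  derive1 (fun s => u (s, q.2)) q.1.

Definition D_x (R : realType) (u : R * R -> R) (q : R * R) : R :=
  derive1 (fun y => u (q.1, y)) q.2.

(* The trace u_x(t, -l), a derivative from the right. *)
Definition D_x_left_end (R : realType) (l : R) (u : R * R -> R) (t : R) : R :=
  derive_within `[(- l), l] (fun y => u (t, y)) (- l).

(* Regularity of a classical solution; u is a total function, but only its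
   values on cOmega l tau matter. *)
Record classical_regularity (R : realType) (l tau : R) (u : R * R -> R) :
    Prop := ClassicalRegularity {
  cr_continuous : {within cOmega l tau, continuous u};
  cr_derivable_t : forall t x : R, Omega l tau (t, x) ->
    derivable (fun s => u (s, x)) t 1;
  cr_derivable_x : forall t x : R, Omega l tau (t, x) ->
    derivable (fun y => u (t, y)) x 1;
  cr_derivable_xx : forall t x : R, Omega l tau (t, x) ->
    derivable (fun y => D_x u (t, y)) x 1;
  cr_continuous_t : {within Omega l tau, continuous (D_t u)};
  cr_continuous_xx : {within Omega l tau, continuous (D_x (D_x u))};
  cr_boundary_t : forall t x : R, 0 < t < tau -> x = - l \/ x = l ->
    derivable (fun s => u (s, x)) t 1;
  cr_boundary_x : forall t x : R, 0 < t < tau -> x = - l \/ x = l ->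
    derivable_within `[(- l), l] (fun y => u (t, y)) x
}.

(* The coefficients a, b, f, g take the argument (t, x, z, p). *)
Record classical_solution (R : realType) (l : R) (a b f g : R * R * R * R -> R)
    (u0 : R -> R) (tau : R) (u : R * R -> R) : Prop := ClassicalSolution {
  cs_regularity : classical_regularity l tau u;
  cs_equation : forall t x : R, Omega l tau (t, x) ->
    D_t u (t, x) - a (t, x, u (t, x), D_x u (t, x)) * D_x (D_x u) (t, x)
    = f (t, x, u (t, x), D_x u (t, x));
  cs_dynamical : forall t : R, 0 < t < tau ->
    D_t u (t, - l)
    - b (t, - l, u (t, - l), D_x_left_end l u t) * D_x_left_end l u t
    = g (t, - l, u (t, - l), D_x_left_end l u t);
  cs_dirichlet : forall t : R, 0 < t < tau -> u (t, l) = 0;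
  cs_initial : forall x : R, - l <= x <= l -> u (0, x) = u0 x
}.

(* Main.v *)
(* Kruzhkov's doubling of the space variable.  Let [h] solve [h'' = - psi (h')]
   on [[0, k]] with [h 0 = 0], [h k > 2 M] and [q0 <= h' <= M1]; the integral
   condition is what makes such an [h] exist.  Consider the maximum of
   [u (t, x) - u (t, y) - h (x - y) - e t] over [0 <= x - y <= k].  If it is
   positive, it is attained at some [t > 0] and [0 < x - y < k].  There [u_t] is
   [<= 0] at [x]: either [x = l], or [u_x = h'] and [u_xx <= h'' = - psi (h')],
   and the equation applies.  Likewise [u_t >= 0] at [y]: when [y = - l],
   maximality gives [u_x >= q0] and the dynamical condition applies.  This
   contradicts [d/dt >= 0] because of the term [e t].  Letting [e] tend to [0],
   [u (t, x) - u (t, y) <= h (x - y) <= M1 (x - y)]; the lower bound follows by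
   applying this to [- u]. *)
Require Import Defs.
From HB Require Import structures.
From mathcomp Require Import all_boot all_order all_algebra.
From mathcomp Require Import all_classical all_reals all_analysis.
From mathcomp Require Import lra.

Import Order.TTheory GRing.Theory Num.Theory.
Import numFieldNormedType.Exports.

Local Open Scope classical_set_scope.
Local Open Scope ring_scope.

Set Implicit Arguments.
Unset Strict Implicit.

(** * First and second derivative tests at a maximum *)

(** A negative derivative would make the values just to the left of [x] larger than [f x]. Only the
    left side is compared because the maximum in time may fall on the last time considered. *)
Lemma is_derive_ge0_left_max (R : realType) (f : R -> R) (x d : R) :
  is_derive x 1 f d -> (\forall y \near x, y <= x -> f y <= f x) -> 0 <= d.
Proof.
move=> /is_derive1_caratheodory[s [fs cs sx]] fmax; rewrite leNgt; apply/negP => d0.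
have s0 : \forall y \near x, s y < 0 by apply: (cvgr_lt (s x) cs); rewrite sx.
have /nbhs_ballP[r /= r0 rP] : \forall y \near x,
    s y < 0 /\ (y <= x -> f y <= f x) by apply: filterS2 s0 fmax.
have [|sy fy] := rP (x - r / 2).
  by rewrite /ball /= opprB addrC subrK gtr0_norm; lra.
have := fs (x - r / 2); have : f (x - r / 2) <= f x by apply: fy; lra.
nra.
Qed.

(** The first claim is Fermat's theorem. If [d > 0], then [f'], which vanishes at [x], is positive
    just to the right of [x], and the mean value theorem yields a value above [f x]. *)
Lemma second_derivative_test (R : realType) (f f' : R -> R) (x d : R) :
  (\forall y \near x, is_derive (y : R) 1 f (f' y)) -> is_derive x 1 f' d ->
  (\forall y \near x, f y <= f x) -> f' x = 0 /\ d <= 0.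
Proof.
move=> df df' fmax.
have f'x : f' x = 0.
  have /nbhs_ballP[r /= r0 rP] : \forall y \near x,
    is_derive (y : R) 1 f (f' y) /\ f y <= f x by apply: filterS2 df fmax.
  have inr y : y \in `]x - r, x + r[ -> ball x r y.
    by rewrite in_itv /ball /= => /andP[? ?]; rewrite ltr_norml; lra.
  have xr : x \in `]x - r, x + r[ by rewrite in_itv /=; lra.
  have [D fD] := rP x (inr x xr).
  have [_ <-] := D.
  apply: derive_val; apply: (@derive1_at_max _ f (x - r) (x + r)) => //.
  - lra.
  - by move=> t /inr/rP[[]].
  - by move=> t /inr/rP[].
split=> //; rewrite leNgt; apply/negP => d0.
have /is_derive1_caratheodory[s [fs cs sx]] := df'.
have s0 : \forall y \near x, 0 < s y by apply: (cvgr_gt (s x) cs); rewrite sx.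
have /nbhs_ballP[r /= r0 rP] : \forall y \near x,
    [/\ is_derive (y : R) 1 f (f' y), f y <= f x & 0 < s y].
  by near=> y; split; near: y.
have inr y : x <= y <= x + r / 2 -> ball x r y.
  by move=> /andP[? ?]; rewrite /ball /= ltr_norml; lra.
have [|||c] := @MVT _ f f' x (x + r / 2).
- lra.
- move=> y; rewrite in_itv /= => /andP[? ?].
  by have /rP[] : ball x r y by apply: inr; lra.
- apply: derivable_within_continuous => y; rewrite in_itv /= => /andP[? ?].
  by have /rP[[]] : ball x r y by apply: inr; lra.
rewrite in_itv /= => /andP[xc cx].
have /rP[_ _ sc] : ball x r c by apply: inr; lra.
have /rP[_ fy _] : ball x r (x + r / 2) by apply: inr; lra.
have := fs c; rewrite f'x subr0 => -> E.
have : 0 < s c * (c - x) * (x + r / 2 - x) by rewrite !mulr_gt0//; lra.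
by lra.
Unshelve. all: by end_near. Qed.

(** * Construction of the barrier from the integral condition *)

Lemma antiderivative (R : realType) (k : R -> R) (c : R) :
  continuous k -> exists F : R -> R, forall x, c < x -> is_derive x 1 F (k x).
Proof.
move=> ck; exists (fun x => \int[lebesgue_measure]_(t in `[c, x]) k t) => x cx.
have [||||D E] := @continuous_FTC1_closed R k c x (x + 1).
- by lra.
- apply: continuous_compact_integrable; first exact: segment_compact.
  exact: continuous_subspaceT.
- exact: cx.
- exact: ck.
by apply: DeriveDef; [exact: D|rewrite -derive1E; exact: E].
Qed.

Lemma derive_gt0_increasing (R : realType) (F k : R -> R) (c : R) :
  (forall x, c < x -> is_derive x 1 F (k x)) -> (forall x, c < x -> 0 < k x) ->
  forall x y, c < x -> x < y -> F x < F y.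
Proof.
move=> dF k0 x y cx xy; have [||z] := @MVT _ F k x y xy.
- by move=> z; rewrite in_itv /= => /andP[? ?]; apply: dF; lra.
- apply: derivable_within_continuous => z; rewrite in_itv /= => /andP[? ?].
  by have /dF[] : c < z by lra.
rewrite in_itv /= => /andP[? ?] E.
have : 0 < k z * (y - x) by rewrite mulr_gt0 ?k0//; lra.
by rewrite -E; lra.
Qed.

(** If every increment of [F] from [a] were at most [m], then [F], nondecreasing beyond [a], would
    have a finite limit at infinity, and the integral, being this limit minus [F a], would be at
    most [m]. This covers an infinite integral too. *)
Lemma integral_gt_truncate (R : realType) (k F : R -> R) (a c m : R) :
  c < a -> (forall x, c < x -> is_derive x 1 F (k x)) ->
  {within `[a, +oo[, continuous k} -> (forall x, a <= x -> 0 <= k x) ->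
  (m%:E < \int[lebesgue_measure]_(x in `[a, +oo[) (k x)%:E)%E ->
  exists2 b, a < b & m < F b - F a.
Proof.
move=> ca dF ck k0 mk; apply: contrapT => nb.
have bnd b : a < b -> F b - F a <= m.
  by move=> ab; rewrite leNgt; apply/negP => ?; apply: nb; exists b.
have ndF x y : a <= x -> x <= y -> F x <= F y.
  move=> ax xy; have [||z] := @MVT_segment _ F k x y xy.
  - by move=> z; rewrite in_itv /= => /andP[? ?]; apply: dF; lra.
  - apply: derivable_within_continuous => z; rewrite in_itv /= => /andP[? ?].
    by have /dF[] : c < z by lra.
  rewrite in_itv /= => /andP[? ?] E.
  have : 0 <= k z * (y - x) by rewrite mulr_ge0 ?k0//; lra.
  by rewrite -E; lra.
(* Freezing [F] to the left of [a] gives a function monotone on the whole line with the same limit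
   at infinity. *)
pose G x := F (Num.max x a).
have ubG b : G b <= Num.max m 0 + F a.
  rewrite /G; have [ba|ab] := leP b a.
    by rewrite lerDr le_max lexx orbT.
  have mm : m <= Num.max m 0 by rewrite le_max lexx.
  by have := bnd _ ab; lra.
have GF : \forall x \near +oo, G x = F x.
  by near=> x; rewrite /G max_l//; near: x; exact: nbhs_pinfty_ge.
have cG : G x @[x --> +oo] --> sup (range G).
  apply: nondecreasing_cvgr.
    move=> x y xy; apply: ndF; first by rewrite le_max lexx orbT.
    by rewrite ge_max !le_max xy lexx orbT.
  by exists (Num.max m 0 + F a) => _ [x _ <-].
have cF : F x @[x --> +oo] --> sup (range G).
  exact: cvg_trans (near_eq_cvg GF) cG.
have dFa x : a <= x -> derivable F x 1.
  by move=> /(lt_le_trans ca)/dF[].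
move: mk; rewrite (ge0_continuous_FTC2y k0 ck cF).
- rewrite -EFinB lte_fin ltNge => /negP; apply.
  suff : sup (range G) <= m + F a by lra.
  apply: (@cvgr_to_le _ _ _ _ F _ _ cF); near=> x.
  have : a < x by near: x; apply: nbhs_pinfty_gt; rewrite num_real.
  by move/bnd; lra.
- move=> x ax; by apply: dFa; exact: ltW.
- apply: cvg_at_right_filter.
  exact/differentiable_continuous/derivable1_diffP/dFa.
- move=> x; rewrite in_itv /= andbT => ax.
  by rewrite derive1E; have [_ ->] := dF x (lt_trans ca ax).
Unshelve. all: by end_near. Qed.

Lemma is_derive_cstB (R : realType) (f : R -> R) (c x d : R) :
  is_derive x 1 f d -> is_derive x 1 (fun y => c - f y) (- d).
Proof.
move=> df; rewrite -[- d]add0r.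
exact: (@is_deriveB _ _ _ (cst c) f).
Qed.

(* With [F' = 1 / P], the function [phi s := F^-1 (F b - s)] solves
   [phi' = - P phi]; since [H' = rho / P rho], the primitive of [phi] is
   [H b - H (phi s)], and no second integration is needed. *)
Lemma barrier (R : realType) (P : R -> R) (a m : R) :
  continuous P -> (forall x, 0 < P x) -> 0 <= a ->
  (m%:E < \int[lebesgue_measure]_(x in `[a, +oo[) (x / P x)%:E)%E ->
  exists b k (h phi : R -> R), [/\ 0 < k, h 0 = 0, m < h k &
    forall s, 0 <= s <= k -> [/\ is_derive s 1 h (phi s),
      is_derive s 1 phi (- P (phi s)), a <= phi s & phi s <= b]].
Proof.
move=> cP P_gt0 a_ge0 mP.
have cPV : continuous (fun x : R => (P x)^-1).
  by move=> x; apply: cvgV; [rewrite gt_eqF|exact: cP].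
have cxP : continuous (fun x : R => x / P x).
  by move=> x; apply: cvgM; [exact: cvg_id|exact: cPV].
(* Starting both primitives at [a - 1] makes them differentiable from both sides at [a]. *)
have [F dF] := antiderivative (a - 1) cPV.
have [H dH] := antiderivative (a - 1) cxP.
have a1a : a - 1 < a by lra.
have [||b ab mb] := integral_gt_truncate a1a dH _ _ mP.
- exact: continuous_subspaceT.
- by move=> x ax; apply: divr_ge0; [exact: le_trans ax|exact: ltW].
have incF : forall x y, a - 1 < x -> x < y -> F x < F y.
  by apply: derive_gt0_increasing dF _ => x _; rewrite invr_gt0.
have injF x y : a - 1 < x -> a - 1 < y -> F x = F y -> x = y.
  move=> ax ay Fxy; have [xy|yx|//] := ltgtP x y.
    by have := incF _ _ ax xy; rewrite Fxy ltxx.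
  by have := incF _ _ ay yx; rewrite Fxy ltxx.
(* [g] inverts [F] on the half-line beyond [a - 1]; the default 0 occurs only off the range of [F]
   there. *)
pose g y := xget 0 [set x | a - 1 < x /\ F x = y].
have FK x : a - 1 < x -> g (F x) = x.
  move=> ax; rewrite /g; case: xgetP => [z _ [az Fz]|/(_ x)].
    exact: injF.
  by move=> /not_andP[].
have near_a (x : R) : a <= x -> \forall y \near x, a - 1 < (y : R).
  by move=> ax; apply: lt_nbhsr; lra.
have dg x : a <= x -> is_derive (F x) 1 g (P x).
  move=> ax; rewrite -[P x]invrK; apply: is_derive_inverse.
  - by apply: filterS (near_a _ ax) => y; exact: FK.
  - apply: filterS (near_a _ ax) => y ay.
    by apply/differentiable_continuous/derivable1_diffP; have [] := dF _ ay.
  - by apply: dF; lra.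
  - by rewrite invr_eq0 gt_eqF.
(* With this length [k], [phi] falls from [b] at 0 to [a] at [k], and [h k = H b - H a > m]. *)
exists b, (F b - F a), (fun s => H b - H (g (F b - s))), (fun s => g (F b - s)).
have Fab : F a < F b by apply: incF.
split.
- by rewrite subr_gt0.
- by rewrite subr0 FK ?subrr//; lra.
- by rewrite subKr FK.
move=> s /andP[s0 sk].
(* Since [F b - s] lies between [F a] and [F b], its preimage [phi s] lies in [[a, b]]. *)
have [|||x] := @IVT R F a b (F b - s).
- exact: ltW.
- apply: derivable_within_continuous => y; rewrite in_itv /= => /andP[ay _].
  by have /dF[] : a - 1 < y by lra.
- by rewrite min_l ?max_r ?(ltW Fab)//; lra.
rewrite in_itv /= => /andP[ax xb] Fx.
have gx : g (F b - s) = x by rewrite -Fx FK//; lra.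
have dphi : is_derive s 1 (fun s => g (F b - s)) (- P x).
  rewrite -mulrN1; apply: (@is_derive1_comp _ g (fun s => F b - s)).
    by rewrite -Fx; exact: dg.
  exact: is_derive_cstB.
rewrite gx; split=> //.
rewrite -[X in is_derive _ _ _ X]opprK; apply: is_derive_cstB.
(* The factor [1 / P] in [H'] cancels the [- P] of [phi'], which leaves [h' = phi]. *)
have -> : - x = x / P x * - P x by rewrite mulrN divfK// gt_eqF.
apply: (@is_derive1_comp _ H (fun s => g (F b - s))) => //.
by rewrite gx; apply: dH; lra.
Qed.

(** * Auxiliary facts on continuity, derivatives and increments *)

Lemma within_continuous_comp (T U V : topologicalType) (A : set T) (B : set U)
    (p : T -> U) (f : U -> V) :
  continuous p -> (forall x, A x -> B (p x)) -> {within B, continuous f} ->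
  {within A, continuous (f \o p)}.
Proof.
move=> cp pAB /subspace_continuousP cf; apply/subspace_continuousP => x Ax W fW.
have /= BW := cf _ (pAB _ Ax) _ fW.
have := cp x _ BW; rewrite /= !nbhs_simpl /=.
by apply: filterS => y /= + Ay; apply; exact: pAB.
Qed.

Lemma near_between (R : realType) (a b x : R) :
  a < x -> x < b -> \forall y \near x, a < y < b.
Proof.
move=> ax xb; have := lt_nbhsl xb; have := lt_nbhsr ax.
by apply: filterS2 => y -> ->.
Qed.

Lemma is_derive_shift (R : realType) (f : R -> R) (c x d : R) :
  is_derive (x - c) 1 f d -> is_derive x 1 (fun y => f (y - c)) d.
Proof.
move=> df; rewrite -[d]mulr1; apply: (@is_derive1_comp _ f (fun y => y - c)) => //.
rewrite -[1 in X in is_derive _ _ _ X]subr0.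
exact: (@is_deriveB _ _ _ id (cst c)).
Qed.

Lemma is_derive_reflect (R : realType) (f : R -> R) (c x d : R) :
  is_derive (c - x) 1 f d -> is_derive x 1 (fun y => f (c - y)) (- d).
Proof.
move=> df; rewrite -mulrN1; apply: (@is_derive1_comp _ f (fun y => c - y)) => //.
exact: is_derive_cstB.
Qed.

Lemma is_derive_sub (R : realType) (f g : R -> R) (x df dg : R) :
  is_derive x 1 f df -> is_derive x 1 g dg ->
  is_derive x 1 (fun y => f y - g y) (df - dg).
Proof. by move=> hf hg; exact: (@is_deriveB _ _ _ f g). Qed.

(** Mean value theorem. Applied to [- h], it also turns an upper bound on [phi] into one on the
    growth of [h]. *)
Lemma derive_ge_increment (R : realType) (h phi : R -> R) (k a : R) :
  (forall s, 0 <= s <= k -> is_derive s 1 h (phi s)) ->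
  (forall s, 0 <= s <= k -> a <= phi s) ->
  forall s s', 0 <= s -> s <= s' -> s' <= k -> a * (s' - s) <= h s' - h s.
Proof.
move=> dh ah s s' s0 ss sk.
have sub z : z \in `[s, s'] -> 0 <= z <= k.
  by rewrite in_itv /= => /andP[sz zs]; rewrite (le_trans s0 sz) (le_trans zs sk).
have [||z /sub zk ->] := @MVT_segment _ h phi s s' ss.
- by move=> z /subset_itv_oo_cc/sub; exact: dh.
- by apply: derivable_within_continuous => z /sub/dh[].
by rewrite ler_wpM2r ?subr_ge0// ah.
Qed.

(** * The class of functions to which the comparison applies *)

(* The consequences of the hypotheses on [u] that are invariant under
   [u |-> - u], so that the upper bound on [u_x] also gives the lower one. *)
Record gradient_class (R : realType) (l tau M q0 : R) (P : R -> R)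
    (u : R * R -> R) (ut ux uxx : R -> R -> R) (p : R -> R) : Prop :=
  GradientClass {
  gc_continuous : {within cOmega l tau, continuous u};
  gc_dt : forall t x, 0 < t < tau -> - l <= x < l ->
    is_derive t 1 (fun s => u (s, x)) (ut t x);
  gc_dx : forall t x, 0 < t < tau -> - l < x < l ->
    is_derive x 1 (fun y => u (t, y)) (ux t x);
  gc_dxx : forall t x, 0 < t < tau -> - l < x < l ->
    is_derive x 1 (ux t) (uxx t x);
  gc_interior : forall t x, 0 < t < tau -> - l < x < l ->
    exists2 a, 0 < a & `|ut t x - a * uxx t x| <= a * P `|ux t x|;
  gc_left_slope : forall t, 0 < t < tau ->
    (u (t, y) - u (t, - l)) / (y - - l) @[y --> (- l)^'+] --> p t;
  gc_left_ge : forall t, 0 < t < tau -> q0 <= p t -> 0 <= ut t (- l);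
  gc_left_le : forall t, 0 < t < tau -> p t <= - q0 -> ut t (- l) <= 0;
  gc_right : forall t, 0 < t < tau -> u (t, l) = 0;
  gc_initial : forall x y, - l <= x <= l -> - l <= y <= l ->
    `|u (0, x) - u (0, y)| <= q0 * `|x - y|;
  gc_bound : forall t x, 0 < t < tau -> - l <= x <= l -> `|u (t, x)| <= M
}.

(** The interior, initial and size conditions involve absolute values only, and negation exchanges
    [gc_left_ge] and [gc_left_le]. *)
Lemma gradient_classN (R : realType) (l tau M q0 : R) (P : R -> R)
    (u : R * R -> R) (ut ux uxx : R -> R -> R) (p : R -> R) :
  gradient_class l tau M q0 P u ut ux uxx p ->
  gradient_class l tau M q0 P (fun q => - u q) (fun t x => - ut t x)
    (fun t x => - ux t x) (fun t x => - uxx t x) (fun t => - p t).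
Proof.
case=> cu dt dx dxx int ls lg ll ru u0 uM; split.
- by move=> q; apply: cvgN; exact: cu.
- by move=> t x ht hx; have := dt t x ht hx => ?; exact: is_deriveN.
- by move=> t x ht hx; have := dx t x ht hx => ?; exact: is_deriveN.
- by move=> t x ht hx; have := dxx t x ht hx => ?; exact: is_deriveN.
- move=> t x ht hx; have [a a0 ha] := int t x ht hx; exists a => //.
  by rewrite mulrN -opprD !normrN.
- move=> t ht; rewrite (_ : (fun y => _) =
    - (fun y => (u (t, y) - u (t, - l)) / (y - - l))); first exact: cvgN (ls t ht).
  by apply/funext => y; rewrite /= -[RHS]mulNr opprB opprK addrC.
- by move=> t ht pq; rewrite oppr_ge0; apply: ll => //; rewrite lerNr.
- by move=> t ht pq; rewrite oppr_le0; apply: lg => //; rewrite -lerN2.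
- by move=> t ht; rewrite ru// oppr0.
- by move=> x y hx hy; rewrite -opprD normrN; exact: u0.
- by move=> t x ht hx; rewrite normrN; exact: uM.
Qed.

(** * Sign of the time derivative at the two points of a maximum *)

(** Maximality in [x] gives [ux = phi] and [uxx <= - P phi], so [gc_interior] yields
    [ut <= a * (uxx + P phi) <= 0]. *)
Lemma dt_le0_at_right_point (R : realType) (l tau M q0 k : R) (P : R -> R)
    (h phi : R -> R) (u : R * R -> R) (ut ux uxx : R -> R -> R) (p : R -> R) :
  gradient_class l tau M q0 P u ut ux uxx p ->
  (forall s, 0 <= s <= k -> is_derive s 1 h (phi s)) ->
  forall t x0 y0, 0 < t < tau -> - l < x0 < l -> 0 < x0 - y0 < k ->
  is_derive (x0 - y0) 1 phi (- P (phi (x0 - y0))) -> 0 <= phi (x0 - y0) ->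
  (forall x, - l < x < l -> 0 <= x - y0 <= k ->
    u (t, x) - h (x - y0) <= u (t, x0) - h (x0 - y0)) ->
  ut t x0 <= 0.
Proof.
move=> gc dh t x0 y0 ht hx0 hxy dphi phi_ge0 umax.
have near_x0 : \forall x \near x0, - l < x < l /\ 0 <= x - y0 <= k.
  have xlo : Num.max (- l) y0 < x0 by rewrite gt_max; clear -hx0 hxy; lra.
  have xhi : x0 < Num.min l (y0 + k) by rewrite lt_min; clear -hx0 hxy; lra.
  apply: filterS (near_between xlo xhi) => x; rewrite gt_max lt_min => hx.
  by clear -hx; split; lra.
have [|||uxE uxx0] := @second_derivative_test R
    (fun x => u (t, x) - h (x - y0)) (fun x => ux t x - phi (x - y0)) x0
    (uxx t x0 - - P (phi (x0 - y0))).
- apply: filterS near_x0 => x [hx xy].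
  apply: is_derive_sub; first exact: (gc_dx gc).
  by apply: is_derive_shift; exact: dh.
- apply: is_derive_sub; first exact: (gc_dxx gc).
  exact: is_derive_shift.
- by apply: filterS near_x0 => x [hx xy]; exact: umax.
have [a a0] := gc_interior gc ht hx0.
rewrite (subr0_eq uxE) (ger0_norm phi_ge0) ler_norml => /andP[_].
by clear -a0 uxx0; nra.
Qed.

(** For [y0] in the interior, maximality in [y] gives [ux = phi] and [uxx >= P phi], hence
    [ut >= a * (uxx - P phi) >= 0]. The endpoint is settled by the dynamical condition. *)
Lemma dt_ge0_at_left_point (R : realType) (l tau M q0 k : R) (P : R -> R)
    (h phi : R -> R) (u : R * R -> R) (ut ux uxx : R -> R -> R) (p : R -> R) :
  gradient_class l tau M q0 P u ut ux uxx p ->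
  (forall s, 0 <= s <= k -> is_derive s 1 h (phi s)) ->
  (forall s, 0 <= s <= k -> q0 <= phi s) ->
  forall t x0 y0, 0 < t < tau -> - l <= y0 < l -> x0 <= l -> 0 < x0 - y0 < k ->
  is_derive (x0 - y0) 1 phi (- P (phi (x0 - y0))) -> 0 <= phi (x0 - y0) ->
  (forall y, - l <= y < l -> 0 <= x0 - y <= k ->
    - u (t, y) - h (x0 - y) <= - u (t, y0) - h (x0 - y0)) ->
  0 <= ut t y0.
Proof.
move=> gc dh phi_q0 t x0 y0 ht /andP[ly0 y0l] x0l hxy dphi phi_ge0 umax.
have [yl|ly] := leP y0 (- l).
  have y0E : y0 = - l by apply/le_anti; rewrite yl.
  (* Maximality against nearby [y], together with [h' >= q0], bounds the difference quotients at
     [- l] below by [q0], so [p t >= q0]. *)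
  subst y0; apply: (gc_left_ge gc ht); apply: (cvgr_to_ge (gc_left_slope gc ht)).
  near=> y.
  have ly : - l < y by near: y; exact: nbhs_right_gt.
  have yx0 : y < x0 by near: y; apply: nbhs_right_lt; clear -hxy; lra.
  rewrite ler_pdivlMr ?subr_gt0//.
  have {}umax : - u (t, y) - h (x0 - y) <= - u (t, - l) - h (x0 - - l).
    by apply: umax; clear -ly yx0 x0l hxy; lra.
  have : q0 * (x0 - - l - (x0 - y)) <= h (x0 - - l) - h (x0 - y).
    by apply: (derive_ge_increment dh phi_q0); clear -ly yx0 hxy; lra.
  by clear -umax; nra.
have hy0 : - l < y0 < l by rewrite ly.
have near_y0 : \forall y \near y0, - l < y < l /\ 0 <= x0 - y <= k.
  have ylo : Num.max (- l) (x0 - k) < y0 by rewrite gt_max; clear -ly hxy; lra.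
  have yhi : y0 < Num.min l x0 by rewrite lt_min; clear -y0l hxy; lra.
  apply: filterS (near_between ylo yhi) => y; rewrite gt_max lt_min => hy.
  by clear -hy; split; lra.
have [|||uxE uxx0] := @second_derivative_test R
    (fun y => - u (t, y) - h (x0 - y)) (fun y => - ux t y - - phi (x0 - y)) y0
    (- uxx t y0 - - - - P (phi (x0 - y0))).
- apply: filterS near_y0 => y [hy xy].
  apply: is_derive_sub; first by apply: is_deriveN; exact: (gc_dx gc).
  by apply: is_derive_reflect; exact: dh.
- apply: is_derive_sub; first by apply: is_deriveN; exact: (gc_dxx gc).
  by apply: is_deriveN; exact: is_derive_reflect.
- apply: filterS near_y0 => y [/andP[hy hy'] xy].
  by apply: umax; rewrite ?hy' ?(ltW hy).
have uxE' : ux t y0 = phi (x0 - y0) by clear -uxE; lra.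
have [a a0] := gc_interior gc ht hy0.
rewrite uxE' (ger0_norm phi_ge0) ler_norml => /andP[+ _].
by clear -a0 uxx0; nra.
Unshelve. all: by end_near. Qed.

(** * Doubling of the space variable and the one-sided gradient bound *)

Lemma increment_le_barrier (R : realType) (l tau M q0 b k : R) (P : R -> R)
    (h phi : R -> R) (u : R * R -> R) (ut ux uxx : R -> R -> R) (p : R -> R) :
  0 < l -> gradient_class l tau M q0 P u ut ux uxx p ->
  0 <= q0 -> 0 < k -> h 0 = 0 -> 2 * M < h k ->
  (forall s, 0 <= s <= k -> [/\ is_derive s 1 h (phi s),
    is_derive s 1 phi (- P (phi s)), q0 <= phi s & phi s <= b]) ->
  forall t x y, 0 < t < tau -> - l <= y -> y <= x -> x <= l -> x - y <= k ->
  u (t, x) - u (t, y) <= h (x - y).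
Proof.
move=> l0 gc q0_ge0 k0 h0 hk dh.
move=> t1 x1 y1 /andP[t1_gt0 t1_lt] ly1 yx1 x1l xy1.
have hd s : 0 <= s <= k -> is_derive s 1 h (phi s) by move=> /dh[].
have hq s : 0 <= s <= k -> q0 <= phi s by move=> /dh[].
have t1tau : 0 < t1 < tau by rewrite t1_gt0.
apply/ler_addgt0Pr => e e0.
(* Stopping at [t1 < tau] keeps the time derivatives available at a maximum, even one at [t1]
   itself. *)
pose D : set (R * R * R) :=
  ((`[0, t1] `*` `[- l, l]) `*` `[- l, l]) `&`
  (fun q => q.1.2 - q.2) @^-1` `[0, k].
have Dl q : D q -> cOmega l tau q.1.
  case: q => [[t x] y] [[[/=]]]; rewrite !in_itv /= => /andP[? ?] /andP[? ?] _ _.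
  by split; rewrite /= in_itv /=; lra.
have Dr q : D q -> cOmega l tau (q.1.1, q.2).
  case: q => [[t x] y] [[[/=]]]; rewrite !in_itv /= => /andP[? ?] _ /andP[? ?] _.
  by split; rewrite /= in_itv /=; lra.
have cx : continuous (fun q : R * R * R => q.1.2).
  move=> q; apply: (@continuous_comp _ _ _ fst snd); first exact: cvg_fst.
  exact: cvg_snd.
have cdiff : continuous (fun q : R * R * R => q.1.2 - q.2).
  move=> q; apply: cvgB; [exact: cx|exact: cvg_snd].
have ct : continuous (fun q : R * R * R => q.1.1).
  by move=> q; apply: (@continuous_comp _ _ _ fst fst); exact: cvg_fst.
have cD : compact D.
  apply: compact_closedI.
    by apply: compact_setX; [apply: compact_setX|]; exact: segment_compact.
  by apply: preimage_closed => //; exact: interval_closed.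
(* The slope [e / t1] makes the penalty at time [t1] exactly the allowed error [e]. *)
pose W (q : R * R * R) := u q.1 - u (q.1.1, q.2) - h (q.1.2 - q.2) - e / t1 * q.1.1.
have ch : {within `[0, k], continuous h}.
  by apply: derivable_within_continuous => s; rewrite in_itv /= => /dh[[]].
have cW : {within D, continuous W}.
  have c1 : {within D, continuous (u \o fst)}.
    by apply: within_continuous_comp Dl (gc_continuous gc) => q; exact: cvg_fst.
  have c2 : {within D, continuous (u \o (fun q : R * R * R => (q.1.1, q.2)))}.
    apply: within_continuous_comp Dr (gc_continuous gc) => q.
    exact: (@cvg_pair _ _ _ _ (nbhs q.1.1) (nbhs q.2) _ _ _ _ snd (ct q) cvg_snd).
  have c3 : {within D, continuous (h \o (fun q : R * R * R => q.1.2 - q.2))}.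
    by apply: within_continuous_comp cdiff _ ch => q [].
  have c4 : {within D, continuous (fun q : R * R * R => e / t1 * q.1.1)}.
    by apply: continuous_subspaceT => q; apply: cvgM; [exact: cvg_cst|exact: ct].
  move=> q; apply: cvgB; last exact: c4.
  apply: cvgB; last exact: c3.
  by apply: cvgB; [exact: c1|exact: c2].
have [|[[t0 x0] y0] + maxW] := @compact_EVT_max _ _ W D _ cD cW.
  by exists (0, 0, 0); split => /=; rewrite ?subrr /= !in_itv /=; try lra;
    repeat split; lra.
rewrite inE => -[[[/=]]]; rewrite !in_itv /= => /andP[t0_ge0 t01].
move=> /andP[lx0 x0l] /andP[ly0 y0l] /andP[xy0_ge0 xy0_le].
have {}maxW t x y : 0 <= t <= t1 -> - l <= x <= l -> - l <= y <= l ->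
    0 <= x - y <= k -> W (t, x, y) <= W (t0, x0, y0).
  by move=> *; apply: maxW; rewrite inE; do ![split => //=]; rewrite in_itv.
have /= {}maxW t x y : 0 <= t <= t1 -> - l <= x <= l -> - l <= y <= l ->
    0 <= x - y <= k ->
    u (t, x) - u (t, y) - h (x - y) - e / t1 * t <=
    u (t0, x0) - u (t0, y0) - h (x0 - y0) - e / t1 * t0 := @maxW t x y.
set m := u (t0, x0) - u (t0, y0) - h (x0 - y0) - e / t1 * t0 in maxW.
have [m0|m_gt0] := leP m 0.
  have : u (t1, x1) - u (t1, y1) - h (x1 - y1) - e / t1 * t1 <= m.
    by apply: maxW; clear -t1_gt0 ly1 yx1 x1l xy1; lra.
  rewrite divfK ?gt_eqF//; clear -m0; lra.
exfalso; rewrite /m in m_gt0 maxW; clear m.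
have et1 : 0 < e / t1 by rewrite divr_gt0.
have et0 : 0 <= e / t1 * t0 by rewrite mulr_ge0// ltW.
(* At time 0 the Lipschitz bound with constant [q0] and [h' >= q0] make the maximum nonpositive. *)
have t0_gt0 : 0 < t0.
  rewrite lt_def t0_ge0 andbT; apply/eqP => t00.
  have := derive_ge_increment hd hq (lexx 0) xy0_ge0 xy0_le; rewrite h0 !subr0.
  have : `|u (0, x0) - u (0, y0)| <= q0 * `|x0 - y0|.
    by apply: (gc_initial gc); rewrite ?lx0 ?ly0.
  rewrite (ger0_norm xy0_ge0) => /(le_trans (ler_norm _)).
  by rewrite t00 in m_gt0; clear -m_gt0; lra.
have t0tau : 0 < t0 < tau by rewrite t0_gt0 (le_lt_trans t01).
have uM x : - l <= x -> x <= l -> - M <= u (t0, x) <= M.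
  by move=> lx xl; rewrite -ler_norml (gc_bound gc)// lx.
(* On the diagonal only the penalty is left; at distance [k] the increment of [u] is at most
   [2 * M < h k]. Both contradict a positive maximum. *)
have xy0_gt0 : 0 < x0 - y0.
  rewrite lt_def xy0_ge0 andbT; apply/eqP => E.
  by move: m_gt0; rewrite E h0 (subr0_eq E); clear -et0; lra.
have xy0_lt : x0 - y0 < k.
  rewrite lt_def xy0_le andbT; apply/eqP => E.
  have /andP[_ ux0] := uM _ lx0 x0l; have /andP[uy0 _] := uM _ ly0 y0l.
  by move: m_gt0; rewrite -E; clear -ux0 uy0 et0 hk; lra.
have xy0_in : 0 < x0 - y0 < k by rewrite xy0_gt0.
have /dh[_ dphi phi_ge _] : 0 <= x0 - y0 <= k by rewrite xy0_ge0.
have phi_ge0 := le_trans q0_ge0 phi_ge.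
have t0_in : 0 <= t0 <= t1 by rewrite t0_ge0.
have x0_in : - l <= x0 <= l by rewrite lx0.
have y0_in : - l <= y0 <= l by rewrite ly0.
have y0_lt : y0 < l by rewrite -subr_gt0 (lt_le_trans xy0_gt0)// lerD2r.
have [dX dXP dX0] : exists2 dX, is_derive t0 1 (fun t => u (t, x0)) dX & dX <= 0.
  (* At [x0 = l] the Dirichlet condition makes [u] constant in time, so the derivative is 0. *)
  have [x0_lt|lx] := ltP x0 l; last first.
    have -> : x0 = l by apply/le_anti; rewrite x0l.
    exists 0 => //; apply: (@near_eq_is_derive R R R (cst 0)).
    apply: filterS (near_between t0_gt0 (proj2 (andP t0tau))) => t.
    by move/(gc_right gc).
  exists (ut t0 x0); first by apply: (gc_dt gc); rewrite ?lx0.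
  apply: (dt_le0_at_right_point gc hd t0tau _ xy0_in dphi phi_ge0).
    by rewrite x0_lt andbT; clear -ly0 xy0_gt0; lra.
  move=> x /andP[lx xl] hxy.
  have hx : - l <= x <= l by rewrite !ltW.
  have := maxW t0 x y0 t0_in hx y0_in hxy.
  by clear; lra.
have [dY dYP dY0] : exists2 dY, is_derive t0 1 (fun t => u (t, y0)) dY & 0 <= dY.
  exists (ut t0 y0); first by apply: (gc_dt gc); rewrite ?ly0.
  apply: (dt_ge0_at_left_point gc hd hq t0tau _ x0l xy0_in dphi phi_ge0).
    by rewrite ly0.
  move=> y /andP[ly yl] hxy.
  have hy : - l <= y <= l by rewrite ly ltW.
  have := maxW t0 x0 y t0_in x0_in hy hxy.
  by clear; lra.
have : 0 <= dX - dY - e / t1.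
  apply: (@is_derive_ge0_left_max _
    (fun t => u (t, x0) - u (t, y0) - e / t1 * t) t0).
    apply: is_derive_sub.
    rewrite -[X in is_derive _ _ _ X]mulr1.
    exact: (@is_deriveZ _ _ _ id).
  near=> t => tt0.
  have t_gt0 : 0 < t by near: t; exact: lt_nbhsr.
  have ht : 0 <= t <= t1 by rewrite ltW// (le_trans tt0).
  have hxy : 0 <= x0 - y0 <= k by rewrite xy0_ge0.
  have := maxW t x0 y0 ht x0_in y0_in hxy.
  by clear; lra.
by clear -dX0 dY0 et1; lra.
Unshelve. all: by end_near. Qed.

(** If [ux t x > b], a short step [r / 2] to the left gives an increment of [u] above [b * (r / 2)].
    The barrier allows at most [h (r / 2)], and this is at most [b * (r / 2)] since [h' <= b]. *)
Lemma gradient_le (R : realType) (l tau M q0 b k : R) (P : R -> R)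
    (h phi : R -> R) (u : R * R -> R) (ut ux uxx : R -> R -> R) (p : R -> R) :
  0 < l -> gradient_class l tau M q0 P u ut ux uxx p ->
  0 <= q0 -> 0 < k -> h 0 = 0 -> 2 * M < h k ->
  (forall s, 0 <= s <= k -> [/\ is_derive s 1 h (phi s),
    is_derive s 1 phi (- P (phi s)), q0 <= phi s & phi s <= b]) ->
  forall t x, 0 < t < tau -> - l < x < l -> ux t x <= b.
Proof.
move=> l0 gc q0_ge0 k0 h0 hk dh t x ht /andP[lx xl].
rewrite leNgt; apply/negP => bux.
have /is_derive1_caratheodory[s [us cs sx]] :
    is_derive x 1 (fun y => u (t, y)) (ux t x) by apply: (gc_dx gc) => //; lra.
have sb : \forall y \near x, b < s y by apply: (cvgr_gt (s x) cs); rewrite sx.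
have kx : Num.max (- l) (x - k) < x by rewrite gt_max; lra.
have /nbhs_ballP[r /= r0 rP] : \forall y \near x,
    b < s y /\ Num.max (- l) (x - k) < y < l.
  by apply: filterS2 sb (near_between kx xl).
have [|sy] := rP (x - r / 2).
  by rewrite /ball /= opprB addrC subrK gtr0_norm; lra.
rewrite gt_max => /andP[/andP[ly ky] _].
have := us (x - r / 2).
have : u (t, x) - u (t, x - r / 2) <= h (x - (x - r / 2)).
  by apply: (increment_le_barrier l0 gc q0_ge0 k0 h0 hk dh) => //; lra.
have : h (r / 2) <= b * (r / 2).
  have dNh z : 0 <= z <= k -> is_derive z 1 (fun s => - h s) (- phi z).
    by move=> /dh[dhz _ _ _]; exact: is_deriveN.
  have Nb z : 0 <= z <= k -> - b <= - phi z by move=> /dh[_ _ _ ?]; rewrite lerN2.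
  have : - b * (r / 2 - 0) <= - h (r / 2) - - h 0.
    by apply: (derive_ge_increment dNh Nb); clear -r0 ky; lra.
  by rewrite h0; clear; lra.
rewrite subKr; nra.
Qed.

(** * Passage from classical solutions to the class *)

Lemma derivable_within_cvg (R : realType) (A : set R) (f : R -> R) (x : R) :
  derivable_within A f x -> f y @[y --> within A (nbhs x)] --> f x.
Proof.
set L := lim ((f y - f x) / (y - x) @[y --> within A x^']) => df.
have cid : (y - x) @[y --> within A x^'] --> (0 : R).
  apply: (@cvg_trans _ ((y - x) @[y --> nbhs x])).
    apply: cvg_app => W nW; rewrite /within /dnbhs /within /=.
    by apply: filterS nW => y Wy _ _.
  have : (y - x) @[y --> nbhs x] --> x - x.
    by apply: cvgB; [exact: cvg_id|exact: cvg_cst].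
  by rewrite subrr.
have cf : f y @[y --> within A x^'] --> f x.
  have c : ((f y - f x) / (y - x) * (y - x) + f x) @[y --> within A x^']
      --> L * 0 + f x.
    by apply: cvgD; [apply: cvgM|exact: cvg_cst].
  rewrite mulr0 add0r in c; apply: cvg_trans c; apply: near_eq_cvg.
  rewrite near_withinE /dnbhs near_withinE.
  by near=> y => yx _; rewrite divfK ?subrK// subr_eq0.
(* The limit over the punctured neighbourhood extends to [x] itself, where the value is [f x]. *)
move=> W fW; have nW : \forall y \near x, y != x -> A y -> W (f y) := cf W fW.
change (\forall y \near x, A y -> W (f y)).
apply: filterS nW => y + Ay; have [->|yx] := eqVneq y x; last exact.
by move=> _; exact: nbhs_singleton fW.
Unshelve. all: by end_near. Qed.

(** [barrier] asks for continuity on the whole line, while [psi] is controlled only on the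
    half-line; composing with the absolute value extends it evenly. *)
Lemma C1_within_continuous_norm (R : realType) (psi : R -> R) :
  C1_within `[0, +oo[ psi -> continuous (fun x : R => psi `|x|).
Proof.
move=> [dpsi _] x.
have x0 : `[0, +oo[%classic `|x| by rewrite /= in_itv /= normr_ge0.
apply: (@cvg_comp _ _ _ (fun y : R => `|y|) psi _ _ _ _
  (derivable_within_cvg (dpsi _ x0))) => W nW.
have := @norm_continuous _ _ x _ nW; rewrite /= !nbhs_simpl /=.
by apply: filterS => y; apply; rewrite /= in_itv /= normr_ge0.
Qed.

Lemma left_slope_cvg (R : realType) (l : R) (u : R * R -> R) (t : R) :
  0 < l -> derivable_within `[(- l), l] (fun y => u (t, y)) (- l) ->
  (u (t, y) - u (t, - l)) / (y - - l) @[y --> (- l)^'+] --> D_x_left_end l u t.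
Proof.
move=> l0 du; apply: cvg_trans du.
have ll : - l < l by lra.
move=> W nW.
change (\forall y \near - l, - l < y -> W ((u (t, y) - u (t, - l)) / (y - - l))).
have {}nW : \forall y \near - l, (y : R) != - l -> `[- l, l]%classic y ->
  W ((u (t, y) - u (t, - l)) / (y - - l)) := nW.
apply: filterS2 nW (lt_nbhsl ll) => y + yl ly; apply.
  by rewrite gt_eqF.
by rewrite /= in_itv /= ltW// ltW.
Qed.

(** The bound on the open domain passes to the lateral boundary by continuity; it is what allows the
    condition on [g] to be used at [z = u (t, - l)]. *)
Lemma left_end_bound (R : realType) (l tau M : R) (u : R * R -> R) (t : R) :
  0 < l -> 0 < t < tau -> {within cOmega l tau, continuous u} ->
  (forall x, - l < x < l -> `|u (t, x)| <= M) -> `|u (t, - l)| <= M.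
Proof.
move=> l0 ht cu uM.
have ll : - l < l by lra.
have : {within `[- l, l], continuous (u \o (fun y => (t, y)))}.
  apply: within_continuous_comp cu.
    move=> y; apply: (@cvg_pair _ _ _ _ (nbhs t) (nbhs y) _ _ _ (fun=> t) id).
      exact: cvg_cst.
    exact: cvg_id.
  by move=> y; rewrite /= in_itv /= => hy; split; rewrite /= in_itv /=; lra.
move=> /(continuous_within_itvP _ ll)[_ cl _].
apply: (cvgr_to_le (cvg_norm cl)); near=> y; apply: uM.
by apply/andP; split; near: y; [exact: nbhs_right_gt|exact: nbhs_right_lt].
Unshelve. all: by end_near. Qed.

Lemma classical_solution_gradient_class (R : realType) (q0 M K T l tau : R)
    (psi : R -> R) (a b f g : R * R * R * R -> R) (u0 : R -> R) (u : R * R -> R) :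
  0 < M -> K <= q0 -> 0 < l -> 0 < tau <= T ->
  (forall t x z p, 0 <= t <= T -> - l <= x <= l -> 0 < a (t, x, z, p)) ->
  (forall x y, - l <= x <= l -> - l <= y <= l ->
    `|u0 x - u0 y| <= K * `|x - y|) ->
  (forall t x z p, cOmega l T (t, x) -> - M <= z <= M ->
    `|f (t, x, z, p)| <= a (t, x, z, p) * psi `|p|) ->
  (forall t z p, 0 < t <= T -> - M <= z <= M -> q0 <= p ->
    - g (t, - l, z, p) <= b (t, - l, z, p) * p /\
    g (t, - l, z, - p) <= b (t, - l, z, - p) * p) ->
  classical_solution l a b f g u0 tau u ->
  (forall t x, Omega l tau (t, x) -> `|u (t, x)| <= M) ->
  gradient_class l tau M q0 (fun p => psi `|p|) u (fun t x => D_t u (t, x))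
    (fun t x => D_x u (t, x)) (fun t x => D_x (D_x u) (t, x)) (D_x_left_end l u).
Proof.
move=> M0 Kq0 l0 tauT a0 u0K fpsi gb [[cu dt dx dxx _ _ bt bx] eqn dyn dir ini] uM.
have OmegaP (t x : R) : 0 < t < tau -> - l < x < l -> Omega l tau (t, x).
  by move=> ht hx; split; rewrite /= in_itv.
have uMl (t : R) : 0 < t < tau -> `|u (t, - l)| <= M.
  move=> ht; apply: (left_end_bound l0 ht cu) => x hx.
  by apply: uM; exact: (OmegaP _ _ ht hx).
have is_der (v : R -> R) y : derivable v y 1 -> is_derive y 1 v (derive1 v y).
  by rewrite derive1E; exact: derivableP.
split; first exact: cu.
- move=> t x ht hx; apply: is_der; have [xl|lx] := leP x (- l).
    by apply: bt => //; left; lra.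
  by apply: dt; apply: OmegaP => //; lra.
- by move=> t x ht hx; apply: is_der; apply: dx; exact: (OmegaP _ _ ht hx).
- by move=> t x ht hx; apply: is_der; apply: dxx; exact: (OmegaP _ _ ht hx).
- move=> t x ht hx; exists (a (t, x, u (t, x), D_x u (t, x))).
    by apply: a0; lra.
  rewrite eqn; last exact: (OmegaP _ _ ht hx).
  rewrite normr_id; apply: fpsi.
    by split; rewrite /= in_itv /=; lra.
  by rewrite -ler_norml; apply: uM; exact: (OmegaP _ _ ht hx).
- by move=> t ht; apply: left_slope_cvg => //; apply: bx => //; left.
(* Here [u_t = b * p + g], and the first inequality on [g] makes this nonnegative. The next case
   uses the second inequality at [- p]. *)
- move=> t ht hp; have tT : 0 < t <= T by lra.
  have uz : - M <= u (t, - l) <= M by rewrite -ler_norml uMl.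
  have [+ _] := gb t _ _ tT uz hp.
  by have := dyn t ht; lra.
- move=> t ht; rewrite lerNr => hp; have tT : 0 < t <= T by lra.
  have uz : - M <= u (t, - l) <= M by rewrite -ler_norml uMl.
  have [_] := gb t _ _ tT uz hp; rewrite opprK.
  by have := dyn t ht; lra.
- exact: dir.
- move=> x y hx hy; rewrite !ini//.
  by apply: le_trans (u0K x y hx hy) _; exact: ler_wpM2r.
- move=> t x ht hx; have [xl|lx] := leP x (- l).
    by rewrite (_ : x = - l) ?uMl//; lra.
  have [xl|xl] := ltP x l; first by apply: uM; apply: OmegaP => //; lra.
  by rewrite (_ : x = l) ?dir ?normr0 ?ltW//; lra.
Qed.

(** * Choice of the constant and the two-sided bound *)

Unset Implicit Arguments.
Set Strict Implicit.

Theorem theorem3p3 (R : realType) (q0 M K : R) (psi : R -> R)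
    (M_gt0 : 0 < M) (K_le_q0 : K <= q0)
    (psi_C1 : C1_within `[0, +oo[ psi)
    (psi_ge1 : forall rho : R, 0 <= rho -> 1 <= psi rho)
    (psi_int : ((2 * M)%:E <
      \int[lebesgue_measure]_(rho in `[q0, +oo[) (rho / psi rho)%:E)%E) :
  exists M1 : R,
  forall (T l : R) (a b f g : R * R * R * R -> R) (u0 : R -> R),
    0 < T -> 0 < l ->
    {within `[0, T] `*` `[(- l), l] `*` setT `*` setT, continuous a} ->
    {within `[0, T] `*` `[(- l), l] `*` setT `*` setT, continuous f} ->
    {within `[0, T] `*` setT `*` setT,
      continuous (fun q : R * R * R => b (q.1.1, - l, q.1.2, q.2))} ->
    {within `[0, T] `*` setT `*` setT,
      continuous (fun q : R * R * R => g (q.1.1, - l, q.1.2, q.2))} ->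
    (forall t x z p : R, 0 <= t <= T -> - l <= x <= l -> 0 < a (t, x, z, p)) ->
    (forall t z p : R, 0 <= t <= T -> 0 < b (t, - l, z, p)) ->
    (forall x y : R, - l <= x <= l -> - l <= y <= l ->
      `|u0 x - u0 y| <= K * `|x - y|) ->
    (forall t x z p : R, cOmega l T (t, x) -> - M <= z <= M ->
      `|f (t, x, z, p)| <= a (t, x, z, p) * psi `|p|) ->
    (forall t z p : R, 0 < t <= T -> - M <= z <= M -> q0 <= p ->
      - g (t, - l, z, p) <= b (t, - l, z, p) * p /\
      g (t, - l, z, - p) <= b (t, - l, z, - p) * p) ->
    forall (tau : R) (u : R * R -> R),
      0 < tau <= T ->
      classical_solution l a b f g u0 tau u ->
      (supnorm (Omega l tau) u <= M%:E)%E ->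
      (supnorm (Omega l tau) (D_x u) <= M1%:E)%E.
Proof.
have [q0_lt0|q0_ge0] := ltP q0 0.
  (* The Lipschitz condition forces [0 <= K], so the hypotheses are contradictory. *)
  exists 0 => T l a b f g u0 _ l0 _ _ _ _ _ _ u0K.
  have : `|u0 l - u0 (- l)| <= K * `|l - - l| by apply: u0K; lra.
  have : 0 <= `|u0 l - u0 (- l)| := normr_ge0 _.
  by rewrite (ger0_norm (_ : 0 <= l - - l)); nra.
pose P (p : R) := psi `|p|.
have P_gt0 (p : R) : 0 < P p by apply: lt_le_trans ltr01 _; exact: psi_ge1.
(* As [q0 >= 0], [P] agrees with [psi] on the range of integration. *)
have P_int : ((2 * M)%:E <
    \int[lebesgue_measure]_(rho in `[q0, +oo[) (rho / P rho)%:E)%E.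
  apply: lt_le_trans psi_int _; rewrite le_eqVlt; apply/orP; left; apply/eqP.
  apply: eq_integral => rho; rewrite inE /= in_itv /= andbT => q0rho.
  by rewrite /P ger0_norm// (le_trans q0_ge0).
(* [M1] is the upper bound of [h']; it is fixed before the domain, the coefficients and the solution
   are introduced. *)
have [M1 [k [h [phi [k0 h0 hk dh]]]]] :=
  barrier (C1_within_continuous_norm psi_C1) P_gt0 q0_ge0 P_int.
exists M1 => T l a b f g u0 _ l0 _ _ _ _ a0 _ u0K fpsi gb tau u tauT sol uM.
have {}uM t x : Omega l tau (t, x) -> `|u (t, x)| <= M.
  move=> tx; rewrite -lee_fin; apply: le_trans uM.
  by apply: ereal_sup_ubound; exists (t, x).
have gc := classical_solution_gradient_class M_gt0 K_le_q0 l0 tauT a0 u0K fpsi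
  gb sol uM.
apply: ge_ereal_sup => _ [[t x] [/= ht hx] <-].
rewrite in_itv /= in ht; rewrite in_itv /= in hx.
(* The lower bound on [u_x] is the upper bound for [- u]. *)
rewrite lee_fin ler_norml lerNl.
by rewrite (gradient_le l0 gc q0_ge0 k0 h0 hk dh ht hx)
  (gradient_le l0 (gradient_classN gc) q0_ge0 k0 h0 hk dh ht hx).
Qed.
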